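(* Suppose that Assumption (Traps), stated in the context, holds and that $\mathbb{E}[c_0^\alpha]=\infty$ and $\mathbb{E}[1/c_0^\alpha]=\infty$. Then the distribution of $(c_{-1},1/c_0)$, conditionally on $\rho_0>t$, converges as $t\to+\infty$ to the (degenerate) random variable $(+\infty,+\infty)$.
   Context: $\{c_x\}_{x\in\mathbb{Z}}$ are i.i.d. strictly positive random variables under $\mathbb{P}$ (expectation $\mathbb{E}$), $\lambda>0$ is fixed and $\rho_0:=e^{-\lambda}c_{-1}/c_0$. Convergence is convergence in distribution on $(0,+\infty]^2$. Assumption (Traps). There are slowly varying functions $L_\infty,L_0$ and $\alpha_\infty,\alpha_0>0$ such that for $t>1$ and $\varepsilon<1$, $\mathbb{P}(c_0>t)=L_\infty(t)t^{-\alpha_\infty}$ and $\mathbb{P}(c_0<\varepsilon)=L_0(1/\varepsilon)\varepsilon^{\alpha_0}$, with $\alpha:=\min\{\alpha_0,\alpha_\infty\}<1$. If $\alpha_0=\alpha_\infty$, assume additionally that $v\mapsto L_\infty(e^v)$ and $v\mapsto L_0(e^v)$ are regularly varying with respective indices $\gamma_\infty\neq-1$, $\gamma_0\neq-1$. *)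

(* Defs.v *)
From HB Require Import structures.
From mathcomp Require Import all_boot all_order all_algebra.
From mathcomp Require Import all_classical all_reals all_analysis.

Set Implicit Arguments.
Unset Strict Implicit.
Unset Printing Implicit Defensive.

Import Order.TTheory GRing.Theory Num.Theory.
Import numFieldNormedType.Exports.

Local Open Scope classical_set_scope.
Local Open Scope ring_scope.

(* Regular variation only concerns the behaviour near +oo, so measurability
   and positivity are required on some half-line `[x0, +oo[ only. *)
Definition regularly_varying (R : realType) (gamma : R) (L : R -> R) : Prop :=
  (exists x0 : R, measurable_fun `[x0, +oo[ L /\
                  forall x : R, x0 <= x -> 0 < L x) /\
  forall a : R, 0 < a -> L (a * x) / L x @[x --> +oo] --> a `^ gamma.

Definition slowly_varying (R : realType) (L : R -> R) : Prop :=
  regularly_varying 0 L.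

Definition mutually_independent (R : realType) (d d' : measure_display)
    (T : measurableType d) (T' : measurableType d') (P : probability T R)
    (I : eqType) (X : I -> {RV P >-> T'}) : Prop :=
  forall (s : seq I) (A : I -> set T'), uniq s ->
    (forall i, i \in s -> measurable (A i)) ->
    P [set w | forall i, i \in s -> A i (X i w)] =
    (\prod_(i <- s) P (X i @^-1` A i))%E.

Definition identically_distributed (R : realType) (d d' : measure_display)
    (T : measurableType d) (T' : measurableType d') (P : probability T R)
    (I : Type) (X : I -> {RV P >-> T'}) : Prop :=
  forall (i j : I) (A : set T'), measurable A ->
    distribution P (X i) A = distribution P (X j) A.

Definition iid (R : realType) (d d' : measure_display)
    (T : measurableType d) (T' : measurableType d') (P : probability T R)
    (I : eqType) (X : I -> {RV P >-> T'}) : Prop :=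
  mutually_independent X /\ identically_distributed X.

(* E[Y | A] for an event A of positive probability. *)
Definition cond_expectation (R : realType) (d : measure_display)
    (T : measurableType d) (P : probability T R) (A : set T) (Y : T -> R) : R :=
  Rintegral P A Y / fine (P A).

(* X and Z are S-valued.  The law of X conditionally on A t converges weakly on
   the space S, as t --> +oo, to the law of Z: convergence of the integrals of
   all bounded continuous test functions on S. *)
Definition cond_cvg_in_distribution (R : realType) (d : measure_display)
    (T : measurableType d) (P : probability T R) (V : topologicalType)
    (S : set V) (A : R -> set T) (X Z : T -> V) : Prop :=
  forall f : V -> R,
    {within S, continuous f} ->
    (exists M : R, forall v, S v -> `|f v| <= M) ->
    cond_expectation P (A t) (f \o X) @[t --> +oo] -->
      Rintegral P setT (f \o Z).

Definition pos_ereal2 (R : realType) : set (\bar R * \bar R) :=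
  `]0%E, +oo%E] `*` `]0%E, +oo%E].

Definition rho0 (R : realType) (d : measure_display)
    (T : measurableType d) (P : probability T R) (lambda : R)
    (c : int -> {RV P >-> R}) (w : T) : R :=
  expR (- lambda) * c (-1) w / c 0 w.

Definition assumption_traps (R : realType) (d : measure_display)
    (T : measurableType d) (P : probability T R) (X : {RV P >-> R})
    (Linf L0 : R -> R) (ainf a0 : R) : Prop :=
  [/\ slowly_varying Linf /\ slowly_varying L0,
      0 < ainf /\ 0 < a0,
      (forall t : R, 1 < t ->
         P [set w | t < X w] = (Linf t * t `^ (- ainf))%:E) /\
      (forall e : R, 0 < e -> e < 1 ->
         P [set w | X w < e] = (L0 e^-1 * e `^ a0)%:E),
      Num.min a0 ainf < 1 &
      a0 = ainf ->
      exists ginf g0 : R,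
        [/\ ginf != -1, g0 != -1,
            regularly_varying ginf (Linf \o expR) &
            regularly_varying g0 (L0 \o expR)]].

(* Main.v *)
(* Write X = c_{-1} and Y = 1/c_0, so that rho_0 > t reads X * Y > t * e^lambda,
   and F(t) = P(X > t), which is regularly varying of index -ainf. If Y stays
   below M then X * Y > t forces X > t / M, an event of probability O(F(t)). On
   the other hand, slicing along the integer part of Y,
     P(X * Y > t) >= \sum_(1 <= k < n) P(k <= Y < k + 1) * F(t / k),
   and dividing by F(t) and letting t -> +oo gives
   \sum_(1 <= k < n) P(k <= Y < k + 1) * k ^ ainf, which is unbounded in n
   because E[Y^alpha] = +oo and alpha <= ainf. Hence P(Y <= M | X * Y > t) -> 0, and
   exchanging the roles of X and Y gives P(X <= M | X * Y > t) -> 0. *)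

Require Import Defs.
From HB Require Import structures.
From mathcomp Require Import all_boot all_order all_algebra.
From mathcomp Require Import all_classical all_reals all_analysis.
From mathcomp Require Import measurable_realfun ring.

Set Implicit Arguments.
Unset Strict Implicit.
Unset Printing Implicit Defensive.

Import Order.TTheory GRing.Theory Num.Theory.
Import numFieldNormedType.Exports.

Local Open Scope classical_set_scope.
Local Open Scope ring_scope.

(** * Measurability of test functions along a pair of variables *)

(** Boxes with rational endpoints form a countable base of the plane, so [U] is the countable union
    of those it contains. *)
Lemma open_measurable_prod (R : realType) (U : set (R * R)) :
  open U -> measurable U.
Proof.
move=> oU.
pose J (q : rat * rat) : interval R := `]ratr (q.1), ratr (q.2)[.
pose box (q : (rat * rat) * (rat * rat)) : set (R * R) :=
  [set` J q.1] `*` [set` J q.2].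
have boxM q : measurable (box q) by apply: measurableX; exact: measurable_itv.
have -> : U = \bigcup_q (if `[< box q `<=` U >] then box q else set0).
  apply/seteqP; split => [[x y] Uxy|z [q _]]; last first.
    by case: asboolP => // + qz; exact.
  have [[A B] /= [/nbhs_ballP[e e0 eA] /nbhs_ballP[e' e'0 eB]] ABU] :=
    oU _ Uxy.
  have itv_rat (u r : R) : 0 < r -> exists q : rat * rat,
      u \in J q /\ [set` J q] `<=` ball u r.
    move=> r0; have [p] : exists q : rat, ratr q \in `]u - r, u[.
      by apply: rat_in_itvoo; rewrite ltrBlDr ltrDl.
    have [q] : exists q : rat, ratr q \in `]u, u + r[.
      by apply: rat_in_itvoo; rewrite ltrDl.
    rewrite !in_itv /= => /andP[uq qr] /andP[rp pu].
    exists (p, q); rewrite in_itv /= pu uq; split => // v /=.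
    rewrite in_itv /= => /andP[pv vq].
    rewrite /ball /= ltr_distlC (lt_trans rp pv) /=; exact: lt_trans qr.
  have [p [px pA]] := itv_rat x e e0.
  have [q [qy qB]] := itv_rat y e' e'0.
  exists (p, q) => //; case: asboolP => [_|[]]; first by split.
  move=> [u v] [/= /pA/eA Au /qB/eB Bv]; exact: (ABU (u, v)).
apply: countable_bigcupT_measurable; first exact: countableP.
by move=> q; case: asboolP.
Qed.

(** A test function is continuous only within [pos_ereal2]. Its preimage of an open interval, read
    through [EFin] on the open quadrant, is open in the plane, and [(X, Y)] never leaves that
    quadrant. *)
Lemma measurable_comp_pair (R : realType) d (T : measurableType d)
    (f : \bar R * \bar R -> R) (X Y : T -> R) :
  {within @pos_ereal2 R, continuous f} ->
  measurable_fun setT X -> measurable_fun setT Y ->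
  (forall w, 0 < X w) -> (forall w, 0 < Y w) ->
  measurable_fun setT (fun w => f ((X w)%:E, (Y w)%:E)).
Proof.
move=> cf mX mY X0 Y0.
apply: (measurability _ (RGenOpens.measurableE R)).
move=> _ [_ [a [b ->] <-]]; rewrite setTI.
pose U : set (R * R) := [set z | [/\ 0 < z.1, 0 < z.2 &
  `]a, b[%classic (f (z.1%:E, z.2%:E))]].
suff oU : open U.
  have -> : (fun w => f ((X w)%:E, (Y w)%:E)) @^-1` `]a, b[ =
            (fun w => (X w, Y w)) @^-1` U.
    apply/seteqP; split => w; last by move=> -[].
    by move=> fw; split; [exact: X0|exact: Y0|].
  rewrite -[X in measurable X]setTI.
  by apply: measurable_fun_pair => //; exact: open_measurable_prod.
rewrite openE => -[x y] [/= x0 y0 fxy].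
have Sxy : pos_ereal2 (x%:E, y%:E).
  by split => /=; rewrite in_itv /= leey lte_fin andbT.
have /subspace_continuousP/(_ _ Sxy) cfxy := cf.
have := cfxy _ (open_nbhs_nbhs (conj (@interval_open _ (BRight a) (BLeft b) isT isT) fxy)).
rewrite nbhs_filterE /= => -[[A B] /= [nA nB] ABf].
exists (EFin @^-1` A `&` [set u | 0 < u], EFin @^-1` B `&` [set u | 0 < u]) => /=.
  split; apply: filterI => //.
      exact: (open_nbhs_nbhs (conj (@open_gt _ 0) x0)).
    exact: (open_nbhs_nbhs (conj (@open_gt _ 0) y0)).
move=> [u v] [/= [Au u0] [Bv v0]]; split => //.
by apply: (ABf (u%:E, v%:E)) => //; split => /=; rewrite in_itv /= leey lte_fin andbT.
Qed.

Lemma measurable_superlevel (R : realType) d (T : measurableType d)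
    (Z : T -> R) (s : R) :
  measurable_fun setT Z -> measurable [set w | s < Z w].
Proof.
move=> mZ; have -> : [set w | s < Z w] = Z @^-1` `]s, +oo[%classic.
  by apply/seteqP; split => w /=; rewrite in_itv /= andbT.
by rewrite -[X in measurable X]setTI; exact: mZ.
Qed.

Lemma measurable_sublevel (R : realType) d (T : measurableType d)
    (Z : T -> R) (s : R) :
  measurable_fun setT Z -> measurable [set w | Z w <= s].
Proof.
move=> mZ; have -> : [set w | Z w <= s] = Z @^-1` `]-oo, s]%classic.
  by apply/seteqP; split => w /=; rewrite in_itv.
by rewrite -[X in measurable X]setTI; exact: mZ.
Qed.

(** * Infinite moments and integer slices *)

(** If [B] bounded every partial sum, integrating [Y ^ r] slice by slice would give a finite moment.
    The slice of integer part 0 is left out of the sums, since it contributes at most 1. *)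
Lemma truncn_moment_unbounded (R : realType) d (T : measurableType d)
    (P : probability T R) (Y : T -> R) (r a : R) :
  measurable_fun setT Y -> (forall w, 0 < Y w) -> 0 < r -> r <= a ->
  ('E_P[fun w => (Y w `^ r)%R] = +oo)%E ->
  forall B : R, exists n, B < \sum_(k < n)
    fine (P [set w | Num.truncn (Y w) = k.+1]) * k.+1%:R `^ a.
Proof.
move=> mY Y0 r0 ra EY B; apply: contrapT => /forallNP noB.
pose A k := [set w | Num.truncn (Y w) = k].
have AE k : A k = Y @^-1` `[k%:R, k.+1%:R[%classic.
  apply/seteqP; split => w /=; rewrite in_itv /=; last exact: truncn_def.
  by move=> <-; rewrite truncn_itv// ltW.
have mA k : measurable (A k).
  by rewrite AE -[X in measurable X]setTI; apply: mY.
have Afin k : P (A k) = (fine (P (A k)))%:E by rewrite fineK// fin_num_measure.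
pose p k := fine (P (A k)).
have p0 k : 0 <= p k by exact: fine_ge0.
have tA : trivIset setT A by move=> i j _ _ [w [/= <- <-]].
have UA : \bigcup_k A k = setT.
  by apply/seteqP; split => // w _; exists (Num.truncn (Y w)).
have mYr : measurable_fun setT (fun w => Y w `^ r).
  apply: (measurableT_comp (measurable_powR r) mY).
suff : ('E_P[fun w => (Y w `^ r)%R] <= (1 + 2 `^ a * B)%:E)%E.
  by rewrite EY leye_eq.
rewrite unlock -UA (@ge0_integral_bigcup _ _ _ _ A) //; last 2 first.
- by rewrite UA; exact/measurable_EFinP.
- by move=> w _; rewrite lee_fin powR_ge0.
(* On [trunc Y = k], Y `^ r <= (k + 1) `^ a <= 1 + (2 k) `^ a. *)
apply: (@le_trans _ _ (\sum_(0 <= k <oo) (p k + p k * (2 `^ a * (if k is j.+1 then k%:R `^ a else 0)))%:E)%E).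
  apply: lee_nneseries => [k _ _|k _].
    by apply: integral_ge0 => w _; rewrite lee_fin powR_ge0.
  pose q : R := 1 + 2 `^ a * (if k is j.+1 then k%:R `^ a else 0).
  have -> : (p k + p k * (2 `^ a * (if k is j.+1 then k%:R `^ a else 0)))%:E = (q%:E * P (A k))%E.
    by rewrite Afin -EFinM /q mulrDl mul1r mulrC.
  rewrite -integral_cst//.
  apply: ge0_le_integral => //.
  - by move=> w _; rewrite lee_fin powR_ge0.
  - apply/measurable_EFinP; exact: measurable_funS mYr.
  - move=> w Aw; rewrite lee_fin /q.
    have Yk : Y w <= k.+1%:R.
      by rewrite -Aw; exact/ltW/truncnS_gt.
    apply: (@le_trans _ _ (k.+1%:R `^ r)).
      by apply: ge0_ler_powR => //; rewrite ?nnegrE ltW.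
    apply: (@le_trans _ _ (k.+1%:R `^ a)).
      by apply: ler_powR => //; rewrite ler1n.
    case: k {Aw Yk q} => [|k]; first by rewrite powR1 mulr0 addr0.
    rewrite -powRM//; apply: (@le_trans _ _ ((2 * k.+1%:R) `^ a)).
      apply: ge0_ler_powR; rewrite ?nnegrE//; first by rewrite ltW// (lt_le_trans r0).
      by rewrite -natrM ler_nat mul2n -addnn addSnnS leq_addl.
    by rewrite lerDr.
apply: lime_le.
  apply: is_cvg_nneseries => k _ _; rewrite lee_fin addr_ge0// !mulr_ge0// ?powR_ge0//.
  by case: k => // k; exact: powR_ge0.
(* The first sum is the probability of a disjoint union, hence at most 1; the second is [2 ^ a]
   times a partial sum bounded through [noB]. *)
apply: nearW => n; rewrite sumEFin lee_fin big_split /= lerD//.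
  rewrite -lee_fin -sumEFin.
  under eq_bigr do rewrite -Afin.
  rewrite big_mkord -measure_bigsetU//.
  by apply: probability_le1; apply: bigsetU_measurable.
under eq_bigr do rewrite mulrCA; rewrite -mulr_sumr ler_wpM2l ?powR_ge0//.
have /negP := noB n; rewrite -leNgt; apply: le_trans.
(* The term of index 0 vanishes, so the shifted sum has one term fewer than the one bounded by
   [noB]. *)
case: n => [|n]; first by rewrite big_geq ?big_ord0.
rewrite big_nat_recl//= mulr0 add0r big_mkord.
by rewrite [leRHS]big_ord_recr /= lerDl mulr_ge0 ?powR_ge0 ?p0.
Qed.

(** * Tails of products of independent variables *)

Definition tail (R : realType) d (T : measurableType d) (P : probability T R)
  (X : T -> R) (t : R) : R := fine (P [set w | t < X w]).

(** This is regular variation of index [- a]: the argument is divided by [s], as in the slices, so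
    the limit is [s ^ a]. *)
Definition tail_regularly_varying (R : realType) d (T : measurableType d)
    (P : probability T R) (X : T -> R) (a : R) : Prop :=
  (\forall t \near +oo, 0 < tail P X t) /\
  forall s : R, 0 < s -> tail P X (t / s) / tail P X t @[t --> +oo] --> s `^ a.

Definition independent_pair (R : realType) d (T : measurableType d)
    (P : probability T R) (X Y : T -> R) : Prop :=
  forall A B : set R, measurable A -> measurable B ->
    P (X @^-1` A `&` Y @^-1` B) = (P (X @^-1` A) * P (Y @^-1` B))%E.

(* On the slice k + 1 <= Y < k + 2, X > t / (k + 1) implies X * Y > t. *)
Lemma tail_sum_le_tail_mul (R : realType) d (T : measurableType d)
    (P : probability T R) (X Y : T -> R) (t : R) (n : nat) :
  measurable_fun setT X -> measurable_fun setT Y ->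
  (forall w, 0 < X w) -> (forall w, 0 < Y w) -> independent_pair P X Y ->
  \sum_(k < n) fine (P [set w | Num.truncn (Y w) = k.+1]) * tail P X (t / k.+1%:R)
    <= tail P (X \* Y) t.
Proof.
move=> mX mY X0 Y0 XY.
have preimE k : [set w | Num.truncn (Y w) = k] = Y @^-1` `[k%:R, k.+1%:R[%classic.
  apply/seteqP; split => w /=; rewrite in_itv /=; last exact: truncn_def.
  by move=> <-; rewrite truncn_itv// ltW.
have tailE s : [set w | s < X w] = X @^-1` `]s, +oo[%classic.
  by apply/seteqP; split => w /=; rewrite in_itv /= andbT.
pose E k := [set w | t / k.+1%:R < X w] `&` [set w | Num.truncn (Y w) = k.+1].
have mE k : measurable (E k).
  rewrite /E tailE preimE; apply: measurableI;
    rewrite -[X in measurable X]setTI; [exact: mX|exact: mY].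
have PE k : P (E k) = (fine (P [set w | Num.truncn (Y w) = k.+1]) *
                       tail P X (t / k.+1%:R))%:E.
  rewrite /E /tail tailE preimE XY// EFinM muleC !fineK// fin_num_measure//.
    by rewrite -[X in measurable X]setTI; exact: mX.
  by rewrite -[X in measurable X]setTI; exact: mY.
have tE : trivIset setT E.
  by move=> i j _ _ [w [[_ /= Yi] [_ /= Yj]]]; apply: succn_inj; rewrite -Yi -Yj.
have mXY : measurable [set w | t < (X \* Y) w].
  by apply: measurable_superlevel; exact: measurable_funM.
rewrite -lee_fin -sumEFin; under eq_bigr do rewrite -PE.
rewrite -measure_bigsetU// /tail fineK ?fin_num_measure//.
apply: le_measure; rewrite ?inE//; first exact: bigsetU_measurable.
move=> w; rewrite -bigcup_mkord => -[k _ [/= tX Yk]].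
rewrite ltr_pdivrMr// in tX; apply: (lt_le_trans tX).
by rewrite ler_pM2l// -Yk truncn_le ltW.
Qed.

(* Any index [a >= r] is allowed, so the cases a0 = ainf and a0 <> ainf need not
   be separated. *)
Lemma tail_mul_dominates (R : realType) d (T : measurableType d)
    (P : probability T R) (X Y : T -> R) (r a : R) :
  measurable_fun setT X -> measurable_fun setT Y ->
  (forall w, 0 < X w) -> (forall w, 0 < Y w) -> independent_pair P X Y ->
  tail_regularly_varying P X a -> 0 < r -> r <= a ->
  ('E_P[fun w => (Y w `^ r)%R] = +oo)%E ->
  forall B : R, \forall t \near +oo, B * tail P X t <= tail P (X \* Y) t.
Proof.
move=> mX mY X0 Y0 XY [Xpos XRV] r0 ra EY B.
(* The number of slices is fixed before [t] grows, so only finitely many tail ratios have to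
   converge and no uniformity is involved. *)
have [n Bn] := truncn_moment_unbounded mY Y0 r0 ra EY B.
pose p k := fine (P [set w | Num.truncn (Y w) = k]).
have cvgS m : \sum_(k < m) p k.+1 * (tail P X (t / k.+1%:R) / tail P X t)
    @[t --> +oo] --> \sum_(k < m) p k.+1 * k.+1%:R `^ a.
  elim: m => [|m IH].
    by under eq_fun do rewrite big_ord0; rewrite big_ord0; exact: cvg_cst.
  under eq_fun do rewrite big_ord_recr /=; rewrite big_ord_recr /=.
  by apply: cvgD => //; apply: cvgMl_tmp; exact: XRV.
have nearB := cvgr_gt _ (cvgS n) _ Bn.
near=> t.
have tpos : 0 < tail P X t by near: t.
apply: le_trans (tail_sum_le_tail_mul t n mX mY X0 Y0 XY).
rewrite -ler_pdivlMr// mulr_suml; under eq_bigr do rewrite -mulrA.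
by apply/ltW; near: t; exact: nearB.
Unshelve. all: by end_near. Qed.

(** Both sides are compared with [tail P X t]: the left one is eventually at most [M ^ a + 1] times
    it, the 1 being slack over the limit of the ratio, and [tail_mul_dominates] is applied with
    [B = (M ^ a + 1) / e]. *)
Lemma bounded_factor_negligible (R : realType) d (T : measurableType d)
    (P : probability T R) (X Y : T -> R) (r a M e : R) :
  measurable_fun setT X -> measurable_fun setT Y ->
  (forall w, 0 < X w) -> (forall w, 0 < Y w) -> independent_pair P X Y ->
  tail_regularly_varying P X a -> 0 < r -> r <= a ->
  ('E_P[fun w => (Y w `^ r)%R] = +oo)%E -> 0 < M -> 0 < e ->
  \forall t \near +oo,
    fine (P [set w | t < X w * Y w /\ Y w <= M]) <= e * tail P (X \* Y) t.
Proof.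
move=> mX mY X0 Y0 XY XRV r0 ra EY M0 e0.
have dom := tail_mul_dominates mX mY X0 Y0 XY XRV r0 ra EY.
have [Xpos XRV'] := XRV.
have ltM : M `^ a < M `^ a + 1 by rewrite ltrDl.
have nearM := cvgr_lt _ (XRV' _ M0) _ ltM.
have nearD := dom ((M `^ a + 1) / e).
near=> t.
have tpos : 0 < tail P X t by near: t.
apply: (@le_trans _ _ (tail P X (t / M))).
  have mXYle : measurable [set w | t < X w * Y w /\ Y w <= M].
    apply: measurableI; last exact: measurable_sublevel.
    by apply: measurable_superlevel; exact: measurable_funM.
  have mXt : measurable [set w | t / M < X w] by exact: measurable_superlevel.
  apply: fine_le; rewrite ?fin_num_measure//.
  apply: le_measure; rewrite ?inE//.
  move=> w [/= tXY YM]; rewrite ltr_pdivrMr//; apply: lt_le_trans tXY _.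
  by rewrite ler_pM2l.
apply: (@le_trans _ _ ((M `^ a + 1) * tail P X t)).
  by rewrite -ler_pdivrMr//; apply/ltW; near: t; exact: nearM.
by rewrite [leRHS]mulrC -ler_pdivrMr// mulrAC; near: t.
Unshelve. all: by end_near. Qed.

(** * Conditional weak convergence to the corner at infinity *)

(** The limit is a point mass. Where both coordinates exceed a large [M], continuity at the corner
    controls the test function; the rest has small conditional mass, and there boundedness
    suffices. *)
Lemma cond_cvg_in_distribution_pinfty (R : realType) d (T : measurableType d)
    (P : probability T R) (A : R -> set T) (X Y : T -> R) :
  measurable_fun setT X -> measurable_fun setT Y ->
  (forall w, 0 < X w) -> (forall w, 0 < Y w) ->
  (forall t, measurable (A t)) ->
  (\forall t \near +oo, 0 < fine (P (A t))) ->
  (forall M e : R, 0 < M -> 0 < e -> \forall t \near +oo,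
    fine (P (A t `&` [set w | X w <= M])) <= e * fine (P (A t))) ->
  (forall M e : R, 0 < M -> 0 < e -> \forall t \near +oo,
    fine (P (A t `&` [set w | Y w <= M])) <= e * fine (P (A t))) ->
  cond_cvg_in_distribution P (@pos_ereal2 R) A
    (fun w => ((X w)%:E, (Y w)%:E)) (fun=> (+oo%E, +oo%E)).
Proof.
move=> mX mY X0 Y0 mA A0 AX AY f cf [K fK].
have mf := measurable_comp_pair cf mX mY X0 Y0.
set F := fun w => f ((X w)%:E, (Y w)%:E) in mf *.
have -> : Rintegral P setT (f \o (fun=> (+oo%E, +oo%E))) = f (+oo%E, +oo%E).
  transitivity (f (+oo%E, +oo%E) * fine (P setT)); last by rewrite probability_setT mulr1.
  exact: Rintegral_cst.
set l := f (+oo%E, +oo%E).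
have Soo : pos_ereal2 ((+oo%E, +oo%E) : \bar R * \bar R).
  by split => /=; rewrite in_itv /= lexx ltry.
have SXY w : pos_ereal2 ((X w)%:E, (Y w)%:E).
  by split => /=; rewrite in_itv /= leey lte_fin ?X0 ?Y0.
have lK : `|l| <= K by exact: fK.
have FK w : `|F w| <= K by exact: fK.
have K0 : 0 <= K by exact: le_trans lK.
(* [2 * K] bounds the distance from [F] to [l]; adding 1 allows division even when [K] is 0. *)
have ltK : 0 < 2 * K + 1 by rewrite ltr_wpDl// mulr_ge0.
apply/cvgrPdist_le => /= e e0.
have [M M0 fM] : exists2 M : R, 0 < M &
    forall w, M < X w -> M < Y w -> `|F w - l| <= e / 2.
  have /subspace_continuousP/(_ _ Soo)/cvgrPdist_le/(_ (e / 2)) := cf.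
  rewrite divr_gt0// => /(_ isT) [[B C] /= [[M1 [_ BM1]] [M2 [_ CM2]]] BCf].
  (* The 1 makes the threshold positive, as [AX] and [AY] require. *)
  exists (Num.max 1 (Num.max M1 M2)); first by rewrite lt_max ltr01.
  move=> w; rewrite !gt_max => /and3P[_ XM _] /and3P[_ _ YM].
  by rewrite distrC; apply: (BCf (_, _)) => //; split => /=;
    [apply: BM1|apply: CM2]; rewrite /= lte_fin.
(* Each of the two exceptional events then costs [(2 * K + 1) * D = e / 4], leaving [e / 2] for the
   neighbourhood of the corner. *)
pose D := e / (4 * (2 * K + 1)).
have D0 : 0 < D by rewrite divr_gt0// mulr_gt0.
have nX := AX M D M0 D0; have nY := AY M D M0 D0.
near=> t.
have At0 : 0 < fine (P (A t)) by near: t.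
have mAt := mA t.
have Afin : (P (A t) < +oo)%E by rewrite ltey_eq fin_num_measure.
have bint (g : T -> R) : measurable_fun setT g -> (exists N, forall w, `|g w| <= N) ->
    P.-integrable (A t) (EFin \o g).
  move=> mg [N gN]; apply: measurable_bounded_integrable => //.
    exact: measurable_funS mg.
  exists N; split; first exact: num_real.
  by move=> N' NN' w _; apply: le_trans (gN w) _; exact: ltW.
have iF : P.-integrable (A t) (EFin \o F) by apply: bint => //; exists K.
have il : P.-integrable (A t) (EFin \o cst l).
  by apply: bint; [exact: measurable_cst|exists K].
have mFl : measurable_fun setT (fun w => F w - l) by exact: measurable_funB.
have iFl : P.-integrable (A t) (EFin \o (fun w => F w - l)).
  apply: bint => //; exists (K + K) => w.
  by apply: le_trans (ler_normB _ _) _; rewrite lerD.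
(* Writing [l] as the conditional mean of a constant turns the difference into the integral of
   [F - l] over [A t], divided by the probability of [A t]. *)
rewrite /cond_expectation distrC -[X in _ - X](mulfK (lt0r_neq0 At0)).
rewrite -mulrBl -(Rintegral_cst P mAt) -RintegralB// normrM.
rewrite [X in _ * X]gtr0_norm ?invr_gt0// ler_pdivrMr//.
apply: le_trans (le_normr_Rintegral mAt iFl) _.
(* An integrable majorant of the distance from [F] to [l]. *)
pose g w : R := e / 2 + ((2 * K + 1) * \1_[set w | X w <= M] w +
                     (2 * K + 1) * \1_[set w | Y w <= M] w).
have ind (Z : T -> R) : measurable_fun setT Z ->
    P.-integrable (A t) (EFin \o (fun w => \1_[set w | Z w <= M] w : R)).
  move=> mZ; apply: bint.
    by apply: measurable_indic; exact: measurable_sublevel.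
  by exists 1 => w; rewrite indicE; case: (_ \in _); rewrite ?normr1 ?normr0.
have indZ (Z : T -> R) : measurable_fun setT Z ->
    P.-integrable (A t) (EFin \o (fun w => (2 * K + 1) * \1_[set w | Z w <= M] w : R)).
  move=> mZ; have := integrableZl mAt (2 * K + 1) (ind _ mZ).
  by apply: eq_integrable => // w _ /=; rewrite EFinM.
have ics : P.-integrable (A t) (EFin \o cst (e / 2)).
  by apply: bint; [exact: measurable_cst|exists `|e / 2|].
have iXY : P.-integrable (A t) (EFin \o (fun w =>
    (2 * K + 1) * \1_[set w | X w <= M] w + (2 * K + 1) * \1_[set w | Y w <= M] w)).
  have := integrableD mAt (indZ _ mX) (indZ _ mY).
  by apply: eq_integrable => // w _ /=; rewrite EFinD.
have ig : P.-integrable (A t) (EFin \o g).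
  have := integrableD mAt ics iXY.
  by apply: eq_integrable => // w _ /=; rewrite EFinD.
apply: (@le_trans _ _ (Rintegral P (A t) g)).
  apply: le_Rintegral => //.
    have := integrable_abse iFl.
    by apply: eq_integrable.
  move=> w _; rewrite /g !indicE.
  have Fl2 : `|F w - l| <= 2 * K + 1.
    apply: le_trans (ler_normB _ _) _; apply: (@le_trans _ _ (K + K)).
      by rewrite lerD.
    by rewrite mulrDl mul1r lerDl.
  case: (boolP (w \in [set w | X w <= M])) => [_|].
    rewrite mulr1; apply: (le_trans Fl2); rewrite addrCA lerDl addr_ge0//.
      by rewrite ltW// divr_gt0.
    by rewrite mulr_ge0// ltW.
  rewrite notin_setE /= => /negP; rewrite -ltNge => XM.
  case: (boolP (w \in [set w | Y w <= M])) => [_|].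
    rewrite mulr1 mulr0 add0r; apply: (le_trans Fl2); rewrite lerDr.
    by rewrite ltW// divr_gt0.
  rewrite notin_setE /= => /negP; rewrite -ltNge => YM.
  by rewrite !mulr0 !addr0; exact: fM.
have indE (Z : T -> R) : measurable_fun setT Z ->
    Rintegral P (A t) (fun w => \1_[set w | Z w <= M] w : R) =
    fine (P (A t `&` [set w | Z w <= M])).
  by move=> mZ; rewrite /Rintegral integral_indic//; [rewrite setIC|exact: measurable_sublevel].
rewrite /g RintegralD// RintegralD//; try exact: indZ.
rewrite Rintegral_cst// !RintegralZl//; try exact: ind.
rewrite !indE//.
apply: (@le_trans _ _ (e / 2 * fine (P (A t)) +
    ((2 * K + 1) * (D * fine (P (A t))) + (2 * K + 1) * (D * fine (P (A t)))))).
  by rewrite lerD2l lerD// ler_pM2l//; near: t.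
rewrite !mulrA -!mulrDl ler_pM2r// /D.
rewrite le_eqVlt; apply/orP; left; apply/eqP; field; exact: lt0r_neq0.
Unshelve. all: by end_near. Qed.

(** * Transfer of the assumptions on [c] to the two factors *)

(** In the ratio of tails the powers of [t] cancel and leave [s ^ a], while the ratio of the values
    of [L] tends to 1. *)
Lemma tail_regularly_varying_slow (R : realType) d (T : measurableType d)
    (P : probability T R) (X : T -> R) (L : R -> R) (a : R) :
  slowly_varying L ->
  (forall t : R, 1 < t -> P [set w | t < X w] = (L t * t `^ (- a))%:E) ->
  tail_regularly_varying P X a.
Proof.
move=> [[x0 [_ Lpos]] LRV] XL.
have tailE t : 1 < t -> tail P X t = L t * t `^ (- a).
  by move=> t1; rewrite /tail XL.
split.
  near=> t.
  have t1 : 1 < t by near: t; exact/nbhs_pinfty_gt/num_real.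
  rewrite tailE//; apply: mulr_gt0; last by rewrite powR_gt0// (lt_trans ltr01).
  by apply: Lpos; near: t; exact/nbhs_pinfty_ge/num_real.
move=> s s0.
have sV : 0 < s^-1 by rewrite invr_gt0.
have : L (s^-1 * t) / L t * s `^ a @[t --> +oo] --> s `^ a.
  (* The factor 1 is written as a power of exponent 0, the index of a slowly varying function. *)
  rewrite -[X in _ --> X]mul1r -[X in X * _](powRr0 s^-1).
  by apply: cvgMr_tmp; exact: LRV.
apply: cvg_trans; apply: near_eq_cvg; near=> t.
have t1 : 1 < t by near: t; exact/nbhs_pinfty_gt/num_real.
(* This gives [t / s > 1], the range where the formula for the tail holds. *)
have st : s < t by near: t; exact/nbhs_pinfty_gt/num_real.
have t0 := lt_trans ltr01 t1.
rewrite !tailE//; last by rewrite ltr_pdivlMr// mul1r.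
rewrite powRM ?(ltW sV) ?(ltW t0)//.
rewrite (_ : s^-1 `^ (- a) = s `^ a); last first.
  by rewrite -powR_inv1 ?(ltW s0)// -powRrM mulN1r opprK.
rewrite mulrC invfM [t / s]mulrC.
have := powR_gt0 (- a) t0 => ta0.
have Lt0 : L t != 0.
  by rewrite gt_eqF//; apply: Lpos; near: t; exact/nbhs_pinfty_ge/num_real.
by field; rewrite Lt0 andbT lt0r_neq0.
Unshelve. all: by end_near. Qed.

Lemma independent_pairC (R : realType) d (T : measurableType d)
    (P : probability T R) (X Y : T -> R) :
  independent_pair P X Y -> independent_pair P Y X.
Proof. by move=> XY A B mA mB; rewrite setIC XY// muleC. Qed.

(** Both sides are integrals of [g] against the common law. As [g] is nonnegative, the change of
    variables covers infinite expectations, which is the case at hand. *)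
Lemma identically_distributed_expectation (R : realType) d (T : measurableType d)
    (P : probability T R) (I : Type) (X : I -> {RV P >-> R}) (i j : I) (g : R -> R) :
  identically_distributed X -> measurable_fun setT g -> (forall x, 0 <= g x) ->
  ('E_P[fun w => g (X i w)] = 'E_P[fun w => g (X j w)])%E.
Proof.
move=> eqd mg g0; rewrite unlock.
have mEg : measurable_fun setT (EFin \o g) by exact/measurable_EFinP.
have Eg0 y : (0 <= (EFin \o g) y)%E by rewrite lee_fin.
rewrite -[LHS](ge0_integral_distribution (X i) mEg Eg0).
rewrite -[RHS](ge0_integral_distribution (X j) mEg Eg0).
by apply: eq_measure_integral => A mA _; exact: eqd.
Qed.

(** * Conclusion for [c_{-1}] and [1 / c_0] *)

Theorem proposition1p5 (R : realType) (d : measure_display)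
    (T : measurableType d) (P : probability T R)
    (c : int -> {RV P >-> R}) (lambda : R)
    (Linf L0 : R -> R) (ainf a0 : R)
    (c_iid : iid c)
    (c_gt0 : forall (x : int) (w : T), 0 < c x w)
    (lambda_gt0 : 0 < lambda)
    (traps : assumption_traps (c 0) Linf L0 ainf a0)
    (E_c0 : ('E_P[fun w => (c 0 w `^ Num.min a0 ainf)%R] = +oo)%E)
    (E_c0V : ('E_P[fun w => (1 / c 0 w `^ Num.min a0 ainf)%R] = +oo)%E) :
  cond_cvg_in_distribution P (@pos_ereal2 R)
    (fun t : R => [set w | t < rho0 lambda c w])
    (fun w => ((c (-1) w)%:E, (1 / c 0 w)%:E))
    (fun=> (+oo%E, +oo%E)).
Proof.
have [[Linf_slow L0_slow] [ainf0 a00] [Pinf P0] _ _] := traps.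
have [c_ind c_id] := c_iid.
pose r := Num.min a0 ainf; rewrite -/r in E_c0 E_c0V.
have r0 : 0 < r by rewrite lt_min a00.
have ra0 : r <= a0 by rewrite ge_min lexx.
have rainf : r <= ainf by rewrite ge_min lexx orbT.
pose X : T -> R := c (-1); pose Y w : R := 1 / c 0 w.
have X0 w : 0 < X w by exact: c_gt0.
have Y0 w : 0 < Y w by rewrite divr_gt0.
have mX : measurable_fun setT X by exact: measurable_funPT.
(* As a power, inversion is measurable by [measurable_powR]; this serves for [mY] and for
   independence. *)
have YE : Y = (fun x => x `^ (-1)) \o c 0.
  by apply/funext => w; rewrite /Y div1r /= powR_inv1// ltW.
have mV := @measurable_powR R (-1).
have mY : measurable_fun setT Y.
  by rewrite YE; apply: measurableT_comp => //; exact: measurable_funPT.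
have XRV : tail_regularly_varying P X ainf.
  apply: tail_regularly_varying_slow Linf_slow _ => t t1; rewrite -Pinf//.
  have := c_id (-1) 0 `]t, +oo[%classic (measurable_itv _).
  rewrite /distribution /pushforward /=; congr (P _ = P _);
    by apply/seteqP; split => w /=; rewrite in_itv /= andbT.
(* [1 / c_0 > t] means [c_0 < 1 / t], so the lower tail of [c_0] at [e = 1 / t] gives
   [L0 t * t ^ (- a0)]. *)
have YRV : tail_regularly_varying P Y a0.
  apply: tail_regularly_varying_slow L0_slow _ => t t1.
  have t0 := lt_trans ltr01 t1.
  have := P0 t^-1; rewrite invr_gt0 t0 invf_lt1// t1 => /(_ isT isT).
  rewrite invrK -[in t^-1 `^ _]powR_inv1 ?(ltW t0)// -powRrM mulN1r => <-.
  congr (P _); apply/seteqP; split => w /=; rewrite /Y div1r.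
    by move=> tc; rewrite -[ltLHS]invrK ltf_pV2 ?posrE ?invr_gt0 ?c_gt0.
  by move=> ct; rewrite -[ltLHS]invrK ltf_pV2 ?posrE ?invr_gt0 ?c_gt0.
have XY : independent_pair P X Y.
  move=> A B mA mB; rewrite YE comp_preimage.
  (* Only the indices -1 and 0 are tested, so the default value [A] serves as the set for index
     -1. *)
  pose C (i : int) := if i == 0 then (fun x : R => x `^ (-1)) @^-1` B else A.
  have mC i : i \in [:: -1 : int; 0] -> measurable (C i).
    move=> _; rewrite /C; case: ifP => // _.
    by rewrite -[X in measurable X]setTI; exact: mV.
  have := c_ind [:: -1 : int; 0] C isT mC.
  rewrite !big_cons big_nil mule1 /C /= => <-; congr (P _).
  apply/seteqP; split => w /=.
    by move=> [Aw Bw] i; rewrite !inE => /orP[] /eqP ->.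
  move=> H; split; first by have := H (-1); rewrite !inE eqxx => /(_ isT).
  by have := H 0; rewrite !inE eqxx orbT => /(_ isT).
have YX := independent_pairC XY.
have EX : ('E_P[fun w => (X w `^ r)%R] = +oo)%E.
  rewrite -E_c0.
  apply: (identically_distributed_expectation (-1) 0 c_id (measurable_powR r)).
  by move=> x; exact: powR_ge0.
have EY : ('E_P[fun w => (Y w `^ r)%R] = +oo)%E.
  rewrite -E_c0V; congr expectation; apply/funext => w.
  by rewrite /Y !div1r -powRN -powR_inv1 ?(ltW (c_gt0 _ _))// -powRrM mulN1r.
(* The conditioning event is the tail event of [X * Y] at level [t * k]; eventual bounds are
   transported along [t * k --> +oo]. *)
pose k := expR lambda.
have k0 : 0 < k by exact: expR_gt0.
have AE t : [set w | t < rho0 lambda c w] = [set w | t * k < X w * Y w].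
  have rhoE w : rho0 lambda c w = X w * Y w / k.
    by rewrite /rho0 expRN /Y div1r -mulrA mulrC.
  by apply/seteqP; split => w /=; rewrite rhoE ltr_pdivlMr.
have tk : t * k @[t --> +oo] --> +oo by apply: gt0_cvgMly => //; exact: cvg_id.
have mXY : measurable_fun setT (X \* Y) by exact: measurable_funM.
(* The roles are exchanged: [Y] supplies the tail, of index [a0], and [X] the infinite moment. Both
   uses are possible because [r] is at most [a0] and at most [ainf]. *)
have fX M e : 0 < M -> 0 < e -> \forall t \near +oo,
    fine (P [set w | t * k < Y w * X w /\ X w <= M]) <= e * tail P (Y \* X) (t * k).
  by move=> M0 e0; exact: tk _ (bounded_factor_negligible mY mX Y0 X0 YX YRV r0 ra0 EX M0 e0).
have fY M e : 0 < M -> 0 < e -> \forall t \near +oo,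
    fine (P [set w | t * k < X w * Y w /\ Y w <= M]) <= e * tail P (X \* Y) (t * k).
  by move=> M0 e0; exact: tk _ (bounded_factor_negligible mX mY X0 Y0 XY XRV r0 rainf EY M0 e0).
have tpos : \forall t \near +oo, 0 < tail P (X \* Y) t.
  have [Xpos _] := XRV.
  (* With [B = 1], eventual positivity passes from the tail of [X] to that of the product. *)
  have dom := tail_mul_dominates mX mY X0 Y0 XY XRV r0 rainf EY 1.
  near=> t; apply: (@lt_le_trans _ _ (1 * tail P X t)); last by near: t.
  by rewrite mul1r; near: t.
have YXE : Y \* X = X \* Y by apply/funext => w /=; rewrite mulrC.
apply: cond_cvg_in_distribution_pinfty => //.
- by move=> t; rewrite AE; exact: measurable_superlevel mXY.
- have tposk : \forall t \near +oo, 0 < tail P (X \* Y) (t * k) := tk _ tpos.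
  by near=> t; rewrite AE; near: t.
- move=> M e M0 e0; near=> t; rewrite AE.
  have -> : [set w | t * k < X w * Y w] `&` [set w | X w <= M] =
            [set w | t * k < Y w * X w /\ X w <= M].
    by apply/seteqP; split => w /=; rewrite [Y w * X w]mulrC.
  by rewrite -/(tail P (X \* Y) (t * k)) -YXE; near: t; exact: fX.
- by move=> M e M0 e0; near=> t; rewrite AE; near: t; exact: fY.
Unshelve. all: by end_near. Qed.
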